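(* There are equivalences of categories $$\mathsf{Poly}\simeq\mathsf{Cont}\qquad\text{and}\qquad\mathsf{Dir}\simeq\mathsf{Bun}.$$ In particular, this gives an equivalence $\mathsf{Poly}_{\mathrm{cart}}\simeq\mathsf{Dir}_{\mathrm{cart}}$ between the category of polynomial functors and cartesian natural transformations and the category of Dirichlet functors and cartesian natural transformations.
   Context: $\mathsf{Fin}$ is the category of finite sets and functions. For a finite set $k$, write $\mathcal{y}^k=\mathsf{Fin}(k,-)\colon\mathsf{Fin}\to\mathsf{Fin}$ and $k^{\mathcal{y}}=\mathsf{Fin}(-,k)\colon\mathsf{Fin}^{\mathrm{op}}\to\mathsf{Fin}$. A polynomial functor is a functor $P\colon\mathsf{Fin}\to\mathsf{Fin}$ that can be expressed as a sum (coproduct) of co-representables, $P\cong\sum_{i=1}^{P(1)}\mathcal{y}^{p_i}$. A Dirichlet functor is a functor $D\colon\mathsf{Fin}^{\mathrm{op}}\to\mathsf{Fin}$ that can be expressed as a sum of representable presheaves, $D\cong\sum_{i=1}^{D(0)}(d_i)^{\mathcal{y}}$. Sums are finite, possibly empty. $\mathsf{Poly}$ is the (skeleton of the) full subcategory of the functor category $\mathsf{Fin}^{\mathsf{Fin}}$ spanned by polynomial functors. $\mathsf{Dir}$ is the (skeleton of the) full subcategory of $\mathsf{Fin}^{(\mathsf{Fin}^{\mathrm{op}})}$ spanned by Dirichlet functors. Morphisms in both are natural transformations. A natural transformation is cartesian if all its naturality squares are pullbacks. $\mathsf{Poly}_{\mathrm{cart}}$ and $\mathsf{Dir}_{\mathrm{cart}}$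 are the subcategories of $\mathsf{Poly}$ and $\mathsf{Dir}$ with all objects and with only the cartesian natural transformations as morphisms. For functions $\pi'\colon s'\to t'$ and $f\colon t\to t'$ between finite sets, $f^*(\pi')\colon t\times_{t'}s'\to t$ denotes the pullback of $\pi'$ along $f$. The categories $\mathsf{Bun}$ and $\mathsf{Cont}$ both have as objects the functions $\pi\colon s\to t$ between finite sets. For objects $\pi\colon s\to t$ and $\pi'\colon s'\to t'$: - a morphism $\pi\to\pi'$ in $\mathsf{Bun}$ (a bundle morphism) is a pair $(f,f_\sharp)$ where $f\colon t\to t'$ is a function and $f_\sharp\colon\pi\to f^*(\pi')$ is a morphism in the slice category $\mathsf{Fin}_{/t}$; - a morphism $\pi\to\pi'$ in $\mathsf{Cont}$ (a container morphism) is a pair $(f,f^\sharp)$ where $f\colon t\to t'$ is a function and $f^\sharp\colon f^*(\pi')\to\pi$ is a morphism in the slice category $\mathsf{Fin}_{/t}$. Composition is the evident one: $\mathsf{Bun}$ is the Grothendieck construction of the self-indexing $\mathsf{Fin}_{/(-)}\colon\mathsf{Fin}^{\mathrm{op}}\to\mathsf{Cat}$ (with reindexing by pullback), and $\mathsf{Cont}$ is the Grothendieck construction of its pointwise opposite $(\mathsf{Fin}_{/(-)})^{\mathrm{op}}\colon\mathsf{Fin}^{\mathrm{op}}\to\mathsf{Cat}$. *)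

(* Defs.v *)
From mathcomp Require Import all_boot boolp.

Set Implicit Arguments.
Unset Strict Implicit.
Unset Printing Implicit Defensive.

Declare Scope cat_scope.
Delimit Scope cat_scope with cat.
Local Open Scope cat_scope.

#[local] Obligation Tactic := idtac.

Record category := Category {
  ob :> Type;
  hom : ob -> ob -> Type;
  idm : forall X, hom X X;
  comp : forall X Y Z, hom Y Z -> hom X Y -> hom X Z;
  comp_idl : forall X Y (f : hom X Y), comp (idm Y) f = f;
  comp_idr : forall X Y (f : hom X Y), comp f (idm X) = f;
  compA : forall X Y Z T (h : hom Z T) (g : hom Y Z) (f : hom X Y),
    comp h (comp g f) = comp (comp h g) f
}.
Arguments hom {c} X Y.
Arguments idm {c} X.
Arguments comp {c X Y Z} g f.

Notation "g ∘ f" := (comp g f) (at level 40, left associativity) : cat_scope.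

Definition op (C : category) : category :=
  @Category C (fun X Y => @hom C Y X) (@idm C)
    (fun X Y Z g f => f ∘ g)
    (fun X Y f => comp_idr f)
    (fun X Y f => comp_idl f)
    (fun X Y Z T h g f => esym (compA f g h)).

Definition isomorphic (C : category) (X Y : C) : Prop :=
  exists (f : hom X Y) (g : hom Y X), g ∘ f = idm X /\ f ∘ g = idm Y.

Record functor (C D : category) := Functor {
  fob :> C -> D;
  fmap : forall X Y : C, hom X Y -> hom (fob X) (fob Y);
  fmap_id : forall X, fmap (idm X) = idm (fob X);
  fmap_comp : forall X Y Z (g : hom Y Z) (f : hom X Y),
    fmap (g ∘ f) = fmap g ∘ fmap f
}.
Arguments fmap {C D} F {X Y} f : rename.

Definition functor_id (C : category) : functor C C :=
  @Functor C C (fun X => X) (fun X Y f => f)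
    (fun X => erefl) (fun X Y Z g f => erefl).

Program Definition functor_comp (C D E : category)
    (G : functor D E) (F : functor C D) : functor C E :=
  @Functor C E (fun X => G (F X)) (fun X Y f => fmap G (fmap F f)) _ _.
Next Obligation. by move=> * /=; rewrite !fmap_id. Qed.
Next Obligation. by move=> * /=; rewrite !fmap_comp. Qed.

Record nat_trans (C D : category) (F G : functor C D) := NatTrans {
  component :> forall X : C, hom (F X) (G X);
  naturality : forall (X Y : C) (f : hom X Y),
    component Y ∘ fmap F f = fmap G f ∘ component X
}.

Lemma nat_trans_ext (C D : category) (F G : functor C D)
  (a b : nat_trans F G) : (forall X, a X = b X) -> a = b.
Proof.
case: a b => [a na] [b nb] /= eab.
have {}eab : a = b by apply: functional_extensionality_dep.
by subst b; congr NatTrans; apply: Prop_irrelevance.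
Qed.

Program Definition nat_id (C D : category) (F : functor C D) : nat_trans F F :=
  @NatTrans C D F F (fun X => idm (F X)) _.
Next Obligation. by move=> * /=; rewrite comp_idl comp_idr. Qed.

Program Definition nat_comp (C D : category) (F G H : functor C D)
    (b : nat_trans G H) (a : nat_trans F G) : nat_trans F H :=
  @NatTrans C D F H (fun X => b X ∘ a X) _.
Next Obligation.
by move=> C D F G H b a X Y f /=; rewrite -compA naturality compA naturality compA.
Qed.

Program Definition functors (C D : category) : category :=
  @Category (functor C D) (@nat_trans C D) (@nat_id C D) (@nat_comp C D) _ _ _.
Next Obligation. by move=> *; apply: nat_trans_ext => Z /=; rewrite comp_idl. Qed.
Next Obligation. by move=> *; apply: nat_trans_ext => Z /=; rewrite comp_idr. Qed.
Next Obligation. by move=> *; apply: nat_trans_ext => U /=; rewrite compA. Qed.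

Definition equivalent (C D : category) : Prop :=
  exists (F : functor C D) (G : functor D C),
    @isomorphic (functors C C) (functor_comp G F) (functor_id C) /\
    @isomorphic (functors D D) (functor_comp F G) (functor_id D).

Definition full_sub (C : category) (P : C -> Prop) : category :=
  @Category {X : C | P X} (fun X Y => hom (sval X) (sval Y))
    (fun X => idm (sval X)) (fun X Y Z g f => g ∘ f)
    (fun X Y f => comp_idl f) (fun X Y f => comp_idr f)
    (fun X Y Z T h g f => compA h g f).

Program Definition wide_sub (C : category)
    (W : forall X Y : C, hom X Y -> Prop)
    (W_id : forall X, W X X (idm X))
    (W_comp : forall X Y Z (g : hom Y Z) (f : hom X Y),
      W Y Z g -> W X Y f -> W X Z (g ∘ f)) : category :=
  @Category C (fun X Y => {f : hom X Y | W X Y f})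
    (fun X => exist _ (idm X) (W_id X))
    (fun X Y Z g f =>
       exist _ (sval g ∘ sval f) (W_comp X Y Z _ _ (svalP g) (svalP f)))
    _ _ _.
Next Obligation.
by move=> C W Wi Wc X Y [f Wf]; apply: eq_exist; rewrite /= comp_idl.
Qed.
Next Obligation.
by move=> C W Wi Wc X Y [f Wf]; apply: eq_exist; rewrite /= comp_idr.
Qed.
Next Obligation.
by move=> *; apply: eq_exist; rewrite /= compA.
Qed.

Definition is_pullback (C : category) (W A B Z : C)
    (p : hom W A) (q : hom W B) (f : hom A Z) (g : hom B Z) : Prop :=
  f ∘ p = g ∘ q /\
  forall (V : C) (a : hom V A) (b : hom V B), f ∘ a = g ∘ b ->
    exists! h : hom V W, p ∘ h = a /\ q ∘ h = b.

Definition cartesian (C D : category) (F G : functor C D)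
    (a : nat_trans F G) : Prop :=
  forall (X Y : C) (f : hom X Y),
    is_pullback (fmap F f) (a X) (a Y) (fmap G f).

Lemma cartesian_id (C D : category) (F : functor C D) : cartesian (nat_id F).
Proof.
move=> X Y f; split=> [|V a b /=]; first by rewrite /= comp_idl comp_idr.
rewrite comp_idl => ->; exists b; split=> [|h []]; first by rewrite comp_idl.
by rewrite comp_idl.
Qed.

Lemma cartesian_comp (C D : category) (F G H : functor C D)
    (b : nat_trans G H) (a : nat_trans F G) :
  cartesian b -> cartesian a -> cartesian (nat_comp b a).
Proof.
move=> cb ca X Y f; split=> [|V u v /= e]; first exact: naturality.
have [_ /(_ V (a Y ∘ u) v) []] := cb X Y f; first by rewrite compA.
move=> w [[w1 w2] w_uniq].
have [_ /(_ V u w (esym w1)) [h [[h1 h2] h_uniq]]] := ca X Y f.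
exists h; split=> [|k [k1 k2]]; first by rewrite -compA h2.
apply: h_uniq; split=> //; apply/esym/w_uniq; split; last by rewrite compA.
by rewrite compA -naturality -compA k1.
Qed.

Definition cartesian_sub (C D : category) (P : functor C D -> Prop) : category :=
  @wide_sub (@full_sub (functors C D) P)
    (fun X Y a => cartesian a)
    (fun X => cartesian_id (sval X))
    (fun X Y Z b a => @cartesian_comp C D (sval X) (sval Y) (sval Z) b a).

Program Definition Fin : category :=
  @Category finType (fun A B => {ffun A -> B})
    (fun A => [ffun x => x]) (fun A B C g f => [ffun x => g (f x)]) _ _ _.
Next Obligation. by move=> *; apply/ffunP => x; rewrite /= !ffunE. Qed.
Next Obligation. by move=> *; apply/ffunP => x; rewrite /= !ffunE. Qed.
Next Obligation. by move=> *; apply/ffunP => x; rewrite /= !ffunE. Qed.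

Definition Fin_hom (A B : finType) : Fin := ({ffun A -> B} : finType).

Program Definition corepresentable (k : finType) : functor Fin Fin :=
  @Functor Fin Fin (fun X => Fin_hom k X)
    (fun X Y (f : @hom Fin X Y) =>
       [ffun u : {ffun k -> X} => (f ∘ (u : @hom Fin k X) : {ffun k -> Y})])
    _ _.
Next Obligation.
by move=> *; apply/ffunP => u; apply/ffunP => x; rewrite /= !ffunE /= ?ffunE.
Qed.
Next Obligation.
by move=> *; apply/ffunP => u; apply/ffunP => x; rewrite /= !ffunE /= ?ffunE.
Qed.

Program Definition representable (k : finType) : functor (op Fin) Fin :=
  @Functor (op Fin) Fin (fun X => Fin_hom X k)
    (fun X Y (f : @hom Fin Y X) =>
       [ffun u : {ffun X -> k} => ((u : @hom Fin X k) ∘ f : {ffun Y -> k})])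
    _ _.
Next Obligation.
by move=> *; apply/ffunP => u; apply/ffunP => x; rewrite /= !ffunE /= ?ffunE.
Qed.
Next Obligation.
by move=> *; apply/ffunP => u; apply/ffunP => x; rewrite /= !ffunE /= ?ffunE.
Qed.

(* Coproducts in [functors C Fin] are pointwise disjoint unions. *)
Definition sum_ob (I : finType) (A : I -> finType) : Fin :=
  ({i : I & A i} : finType).

Program Definition functor_sum (C : category) (I : finType)
    (F : I -> functor C Fin) : functor C Fin :=
  @Functor C Fin (fun X => sum_ob (fun i => F i X))
    (fun X Y f =>
       [ffun u : {i : I & (F i X : finType)} =>
          Tagged (fun i => (F i Y : finType))
                 ((fmap (F (tag u)) f : {ffun _ -> _}) (tagged u))])
    _ _.
Next Obligation.
by move=> C I F X; apply/ffunP => -[i u]; rewrite !ffunE /= fmap_id ffunE.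
Qed.
Next Obligation.
by move=> C I F X Y Z g f; apply/ffunP => -[i u]; rewrite !ffunE /= fmap_comp ffunE.
Qed.

Definition is_polynomial (P : functor Fin Fin) : Prop :=
  exists p : (P (unit : finType) : finType) -> finType,
    @isomorphic (functors Fin Fin)
      P (functor_sum (fun i => corepresentable (p i))).

Definition is_dirichlet (D : functor (op Fin) Fin) : Prop :=
  exists d : (D (void : finType) : finType) -> finType,
    @isomorphic (functors (op Fin) Fin)
      D (functor_sum (fun i => representable (d i))).

(* No skeleton is chosen: a skeleton is equivalent to the whole category. *)
Definition Poly : category := @full_sub (functors Fin Fin) is_polynomial.
Definition Dir : category := @full_sub (functors (op Fin) Fin) is_dirichlet.
Definition Poly_cart : category := cartesian_sub is_polynomial.
Definition Dir_cart : category := cartesian_sub is_dirichlet.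

Record slice_ob (C : category) (t : C) := SliceOb {
  dom : C;
  arr : hom dom t
}.

Program Definition slice (C : category) (t : C) : category :=
  @Category (slice_ob t)
    (fun x y => {h : hom (dom x) (dom y) | arr y ∘ h = arr x})
    (fun x => exist _ (idm (dom x)) _)
    (fun x y z g f => exist _ (sval g ∘ sval f) _) _ _ _.
Next Obligation. by move=> * /=; rewrite comp_idr. Qed.
Next Obligation. by move=> C t x y z [g eg] [f ef] /=; rewrite compA eg. Qed.
Next Obligation.
by move=> C t x y [f ef]; apply: eq_exist; rewrite /= comp_idl.
Qed.
Next Obligation.
by move=> C t x y [f ef]; apply: eq_exist; rewrite /= comp_idr.
Qed.
Next Obligation. by move=> *; apply: eq_exist; rewrite /= compA. Qed.

Arguments slice C t : clear implicits.

Section FiberProduct.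
Variables (t t' s : finType) (f : {ffun t -> t'}) (p : {ffun s -> t'}).

Definition fiber_product : finType := {x : t * s | f x.1 == p x.2}.

Definition fp_mk (a : t) (b : s) (e : f a = p b) : fiber_product :=
  exist _ (a, b) (introT eqP e).

Definition fp_fst (x : fiber_product) : t := (val x).1.
Definition fp_snd (x : fiber_product) : s := (val x).2.

Lemma fp_fst_mk (a : t) (b : s) (e : f a = p b) : fp_fst (fp_mk e) = a.
Proof. by []. Qed.

Lemma fp_snd_mk (a : t) (b : s) (e : f a = p b) : fp_snd (fp_mk e) = b.
Proof. by []. Qed.

Lemma fp_eq (x : fiber_product) : f (fp_fst x) = p (fp_snd x).
Proof. exact/eqP/(valP x). Qed.

Lemma fp_ext (x y : fiber_product) :
  fp_fst x = fp_fst y -> fp_snd x = fp_snd y -> x = y.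
Proof.
case: x y => [[a b] e] [[a' b'] e']; rewrite /fp_fst /fp_snd /= => ea eb.
by apply: val_inj; rewrite /= ea eb.
Qed.
End FiberProduct.

Lemma slice_hom_eq (t : finType) (x y : slice Fin t) (h : hom x y)
  (a : dom x : finType) :
  (arr y : {ffun _ -> _}) ((sval h : {ffun _ -> _}) a) =
  (arr x : {ffun _ -> _}) a.
Proof. by case: h => h /= <-; rewrite ffunE. Qed.

Section Reindex.
Variables (t t' : finType) (f : {ffun t -> t'}).

Definition reindex_ob (x : slice Fin t') : slice Fin t :=
  @SliceOb Fin t (fiber_product f (arr x : {ffun _ -> _}))
    [ffun z => fp_fst z].

Lemma reindex_map_eq (x y : slice Fin t') (h : hom x y)
    (z : fiber_product f (arr x : {ffun _ -> _})) :
  f (fp_fst z) = (arr y : {ffun _ -> _}) ((sval h : {ffun _ -> _}) (fp_snd z)).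
Proof. by rewrite slice_hom_eq fp_eq. Qed.

Program Definition reindex_map (x y : slice Fin t') (h : hom x y) :
    hom (reindex_ob x) (reindex_ob y) :=
  exist _ ([ffun z => fp_mk (reindex_map_eq h z)]) _.
Next Obligation. by move=> *; apply/ffunP => z; rewrite /= !ffunE. Qed.

Program Definition reindex : functor (slice Fin t') (slice Fin t) :=
  @Functor (slice Fin t') (slice Fin t) reindex_ob reindex_map _ _.
Next Obligation.
move=> x; apply: eq_exist; apply/ffunP => z; rewrite !ffunE /=.
by apply: fp_ext; rewrite ?fp_fst_mk ?fp_snd_mk /= !ffunE.
Qed.
Next Obligation.
move=> x y z g h; apply: eq_exist; apply/ffunP => u; rewrite /= !ffunE /=.
by apply: fp_ext; rewrite ?fp_fst_mk ?fp_snd_mk /= !ffunE ?fp_fst_mk ?fp_snd_mk.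
Qed.
End Reindex.

(* Coherence isomorphisms of the self-indexing: the pseudofunctor
   [t |-> slice Fin t] is not strict for this choice of pullbacks. *)

Section ReindexId.
Variables (t : finType) (x : slice Fin t).

Lemma reindex_unit_eq (a : dom x : finType) :
  (@idm Fin t : {ffun _ -> _}) ((arr x : {ffun _ -> _}) a) =
  (arr x : {ffun _ -> _}) a.
Proof. by rewrite ffunE. Qed.

Program Definition reindex_unit : hom x (reindex (@idm Fin t) x) :=
  exist _ ([ffun a => fp_mk (reindex_unit_eq a)]) _.
Next Obligation. by apply/ffunP => a; rewrite /= !ffunE. Qed.

Program Definition reindex_unit_inv : hom (reindex (@idm Fin t) x) x :=
  exist _ ([ffun z => fp_snd z]) _.
Next Obligation.
by apply/ffunP => z; rewrite !ffunE -(fp_eq z) ffunE.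
Qed.
End ReindexId.

Section ReindexComp.
Variables (t t' t'' : finType) (f : {ffun t -> t'}) (g : {ffun t' -> t''}).
Variable x : slice Fin t''.
Let gf : {ffun t -> t''} := @comp Fin t t' t'' g f.
Let px : {ffun (dom x : finType) -> t''} := arr x.

Lemma reindex_mul_eq
    (z : fiber_product f ([ffun y => fp_fst y] : {ffun fiber_product g px -> t'})) :
  gf (fp_fst z) = px (fp_snd (fp_snd z)).
Proof. by rewrite ffunE (fp_eq z) ffunE fp_eq. Qed.

Program Definition reindex_mul : hom (reindex f (reindex g x)) (reindex gf x) :=
  exist _ ([ffun z => fp_mk (reindex_mul_eq z)]) _.
Next Obligation. by apply/ffunP => z; rewrite /= !ffunE. Qed.

Lemma reindex_mul_inv_eq1 (z : fiber_product gf px) :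
  g (f (fp_fst z)) = px (fp_snd z).
Proof. by rewrite -fp_eq ffunE. Qed.

Lemma reindex_mul_inv_eq2 (z : fiber_product gf px) :
  f (fp_fst z) =
  ([ffun y => fp_fst y] : {ffun fiber_product g px -> t'})
    (fp_mk (reindex_mul_inv_eq1 z)).
Proof. by rewrite ffunE. Qed.

Program Definition reindex_mul_inv :
    hom (reindex gf x) (reindex f (reindex g x)) :=
  exist _ ([ffun z => fp_mk (reindex_mul_inv_eq2 z)]) _.
Next Obligation. by apply/ffunP => z; rewrite /= !ffunE. Qed.
End ReindexComp.

Record bundle := Bundle {
  total : finType;
  base : finType;
  proj : {ffun total -> base}
}.

Definition over (p : bundle) : slice Fin (base p) :=
  @SliceOb Fin (base p) (total p) (proj p).

Record bun_hom (p q : bundle) := BunHom {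
  bun_base : {ffun base p -> base q};
  bun_sharp : hom (over p) (reindex bun_base (over q))
}.

Definition bun_id (p : bundle) : bun_hom p p :=
  @BunHom p p (@idm Fin (base p)) (reindex_unit (over p)).

Definition bun_comp (p q r : bundle) (g : bun_hom q r) (f : bun_hom p q) :
    bun_hom p r :=
  @BunHom p r (@comp Fin (base p) (base q) (base r) (bun_base g) (bun_base f))
    (reindex_mul (bun_base f) (bun_base g) (over r)
       ∘ fmap (reindex (bun_base f)) (bun_sharp g) ∘ bun_sharp f).

Record cont_hom (p q : bundle) := ContHom {
  cont_base : {ffun base p -> base q};
  cont_sharp : hom (reindex cont_base (over q)) (over p)
}.

Definition cont_id (p : bundle) : cont_hom p p :=
  @ContHom p p (@idm Fin (base p)) (reindex_unit_inv (over p)).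

Definition cont_comp (p q r : bundle) (g : cont_hom q r) (f : cont_hom p q) :
    cont_hom p r :=
  @ContHom p r (@comp Fin (base p) (base q) (base r) (cont_base g) (cont_base f))
    (cont_sharp f ∘ fmap (reindex (cont_base f)) (cont_sharp g)
       ∘ reindex_mul_inv (cont_base f) (cont_base g) (over r)).

(* The [base] components of two composites are equal but not convertible, so
   equality of morphisms is tested on the underlying functions of the [sharp]
   components. *)

Definition bun_fun (p q : bundle) (f : bun_hom p q) (a : total p) : total q :=
  fp_snd ((sval (bun_sharp f) : {ffun _ -> _}) a).

Lemma bun_fst (p q : bundle) (f : bun_hom p q) (a : total p) :
  fp_fst ((sval (bun_sharp f) : {ffun _ -> _}) a) = proj p a.
Proof. by have := slice_hom_eq (bun_sharp f) a; rewrite ffunE. Qed.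

Lemma bun_hom_ext (p q : bundle) (f g : bun_hom p q) :
  bun_base f = bun_base g -> bun_fun f =1 bun_fun g -> f = g.
Proof.
case: f g => [f u] [g v] /= e; subst g => e; congr BunHom.
case: u v e => [u eu] [v ev] e; apply: eq_exist; apply/ffunP => a.
apply: fp_ext; last exact: e.
rewrite (bun_fst (@BunHom p q f (exist _ u eu)) a).
by rewrite (bun_fst (@BunHom p q f (exist _ v ev)) a).
Qed.

Definition cont_fun (p q : bundle) (f : cont_hom p q) (a : base p) (b : total q)
    (e : cont_base f a = proj q b) : total p :=
  (sval (cont_sharp f) : {ffun _ -> _}) (fp_mk e).

Lemma cont_hom_ext (p q : bundle) (f g : cont_hom p q) :
  cont_base f = cont_base g ->
  (forall a b (e : cont_base f a = proj q b) (e' : cont_base g a = proj q b),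
     cont_fun e = cont_fun e') -> f = g.
Proof.
case: f g => [f u] [g v] /= e; subst g => e; congr ContHom.
case: u v e => [u eu] [v ev] e; apply: eq_exist; apply/ffunP => z.
have -> : z = fp_mk (fp_eq z) by apply: fp_ext.
exact: e.
Qed.

Program Definition Bun : category :=
  @Category bundle bun_hom bun_id bun_comp _ _ _.
Next Obligation.
move=> p q f; apply: bun_hom_ext => [|a] /=; first exact: (@comp_idl Fin).
by rewrite /bun_fun /= !ffunE ?fp_snd_mk /= ?ffunE ?fp_snd_mk.
Qed.
Next Obligation.
move=> p q f; apply: bun_hom_ext => [|a] /=; first exact: (@comp_idr Fin).
by rewrite /bun_fun /= !ffunE ?fp_snd_mk /= ?ffunE ?fp_snd_mk.
Qed.
Next Obligation.
move=> p q r s h g f; apply: bun_hom_ext => [|a] /=; first exact: (@compA Fin).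
by rewrite /bun_fun /= !ffunE ?fp_snd_mk /= ?ffunE ?fp_snd_mk.
Qed.

Lemma proj_cont_fun (p q : bundle) (f : cont_hom p q) a b
  (e : cont_base f a = proj q b) : proj p (cont_fun e) = a.
Proof. by have := slice_hom_eq (cont_sharp f) (fp_mk e); rewrite ffunE. Qed.

Lemma cont_fun_irr (p q : bundle) (f : cont_hom p q) a a' b b'
  (e : cont_base f a = proj q b) (e' : cont_base f a' = proj q b') :
  a = a' -> b = b' -> cont_fun e = cont_fun e'.
Proof.
by move=> ea eb; subst a' b'; rewrite (Prop_irrelevance e e').
Qed.

Lemma cont_fun_id (p : bundle) a b (e : cont_base (cont_id p) a = proj p b) :
  cont_fun e = b.
Proof. by rewrite /cont_fun /= ffunE. Qed.

Lemma cont_fun_comp (p q r : bundle) (g : cont_hom q r) (f : cont_hom p q)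
  a a' b (e : cont_base (cont_comp g f) a = proj r b)
  (eg : cont_base g a' = proj r b) (ef : cont_base f a = proj q (cont_fun eg)) :
  cont_fun e = cont_fun ef.
Proof.
have ea : a' = cont_base f a by rewrite ef proj_cont_fun.
subst a'; rewrite {1 2}/cont_fun /= !ffunE.
congr ((sval _ : {ffun _ -> _}) _).
apply: fp_ext; rewrite ?fp_fst_mk ?fp_snd_mk //.
by rewrite /cont_fun /=; congr ((sval _ : {ffun _ -> _}) _); apply: fp_ext.
Qed.

Program Definition Cont : category :=
  @Category bundle cont_hom cont_id cont_comp _ _ _.
Next Obligation.
move=> p q f; apply: cont_hom_ext => [|a b e e'] /=.
  exact: (@comp_idl Fin).
have eg : cont_base (cont_id q) (cont_base f a) = proj q b by rewrite ffunE.
have ef : cont_base f a = proj q (cont_fun eg) by rewrite cont_fun_id.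
by rewrite (cont_fun_comp e ef); apply: cont_fun_irr; rewrite ?cont_fun_id.
Qed.
Next Obligation.
move=> p q f; apply: cont_hom_ext => [|a b e e'] /=.
  exact: (@comp_idr Fin).
have ef : cont_base (cont_id p) a = proj p (cont_fun e').
  by rewrite proj_cont_fun ffunE.
by rewrite (cont_fun_comp e ef) cont_fun_id.
Qed.
Next Obligation.
move=> p q r s h g f; apply: cont_hom_ext => [|a b e e'] /=.
  exact: (@compA Fin).
have eh : cont_base h (cont_base g (cont_base f a)) = proj s b.
  by rewrite -e' !ffunE.
have eg : cont_base g (cont_base f a) = proj r (cont_fun eh).
  by rewrite proj_cont_fun.
have ef : cont_base f a = proj q (cont_fun eg) by rewrite proj_cont_fun.
have egf : cont_base (cont_comp g f) a = proj r (cont_fun eh).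
  by rewrite proj_cont_fun ffunE.
have ehg : cont_base (cont_comp h g) (cont_base f a) = proj s b.
  by rewrite -eh ffunE.
have ef' : cont_base f a = proj q (cont_fun ehg) by rewrite proj_cont_fun.
rewrite (cont_fun_comp e egf) (cont_fun_comp egf ef) (cont_fun_comp e' ef').
by apply: cont_fun_irr => //; rewrite (cont_fun_comp ehg eg).
Qed.

(* Main.v *)
(** A natural transformation out of a sum of (co)representables is, by Yoneda,
    a choice of one element of the target for each summand.  Hence maps between
    such sums over [C] are maps of families: [i |-> (j, h : d j -> c i)], which
    form a category [Fam C]; [Poly] is the case [C = Fin] and [Dir] the case
    [C = op Fin].  A bundle is the family of its fibers, which identifies [Cont]
    with [Fam Fin] and [Bun] with [Fam (op Fin)].  Evaluating a naturality square
    at the map to the terminal object of [C] (the set 1, resp. the set 0) shows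
    that a transformation is cartesian iff every [h] above is invertible, and
    inverting these [h] exchanges [C] and [op C]. *)

From mathcomp Require Import all_boot boolp.
Require Import Defs.

Set Implicit Arguments.
Unset Strict Implicit.
Unset Printing Implicit Defensive.

Local Open Scope cat_scope.

#[local] Obligation Tactic := idtac.

(** * Equivalences of categories from full, faithful, essentially surjective functors *)

Definition is_iso (C : category) (X Y : C) (f : hom X Y) : Prop :=
  exists g : hom Y X, g ∘ f = idm X /\ f ∘ g = idm Y.

Definition full (C D : category) (F : functor C D) : Prop :=
  forall (X Y : C) (g : hom (F X) (F Y)), exists f, fmap F f = g.

Definition faithful (C D : category) (F : functor C D) : Prop :=
  forall (X Y : C) (f g : hom X Y), fmap F f = fmap F g -> f = g.

Definition ess_surj (C D : category) (F : functor C D) : Prop :=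
  forall Y : D, exists X : C, isomorphic (F X) Y.

Definition weak_equiv (C D : category) (F : functor C D) : Prop :=
  [/\ full F, faithful F & ess_surj F].

Lemma isomorphic_trans (C : category) (X Y Z : C) :
  isomorphic X Y -> isomorphic Y Z -> isomorphic X Z.
Proof.
case=> f [g [gf fg]] [h [k [kh hk]]]; exists (h ∘ f), (g ∘ k); split.
  by rewrite -compA (compA k) kh comp_idl.
by rewrite -compA (compA f) fg comp_idl.
Qed.

Lemma functor_isomorphic (C D : category) (F : functor C D) (X Y : C) :
  isomorphic X Y -> isomorphic (F X) (F Y).
Proof.
case=> f [g [gf fg]]; exists (fmap F f), (fmap F g).
by rewrite -!fmap_comp gf fg !fmap_id.
Qed.

Lemma weak_equiv_comp (C D E : category) (G : functor D E)
    (F : functor C D) :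
  weak_equiv G -> weak_equiv F -> weak_equiv (functor_comp G F).
Proof.
move=> [fullG faithG esG] [fullF faithF esF]; split=> [X Y g|X Y f g /=|Z].
- by have [h <-] := fullG _ _ g; have [f <-] := fullF _ _ h; exists f.
- by move/faithG/faithF.
have [Y YZ] := esG Z; have [X XY] := esF Y; exists X.
exact: isomorphic_trans (functor_isomorphic G XY) YZ.
Qed.

Lemma equivalent_sym (C D : category) : equivalent C D -> equivalent D C.
Proof. by case=> F [G [GF FG]]; exists G, F. Qed.

Section Whisker.
Variables (C D E : category) (F1 : functor C D) (G1 : functor D C).
Variables (F2 : functor D E) (G2 : functor E D).

(** Half of transitivity: the inner isomorphism is whiskered by [F1] and [G1], then followed by the
    outer one. Exchanging the roles of the functors gives the other half. *)
Lemma retract_comp :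
  @isomorphic (functors C C) (functor_comp G1 F1) (functor_id C) ->
  @isomorphic (functors D D) (functor_comp G2 F2) (functor_id D) ->
  @isomorphic (functors C C)
    (functor_comp (functor_comp G1 G2) (functor_comp F2 F1)) (functor_id C).
Proof.
case=> a [a' [a'a aa']] [b [b' [b'b bb']]].
have {}a'a X : a' X ∘ a X = idm _ := congr1 (fun t : nat_trans _ _ => t X) a'a.
have {}aa' X : a X ∘ a' X = idm _ := congr1 (fun t : nat_trans _ _ => t X) aa'.
have {}b'b X : b' X ∘ b X = idm _ := congr1 (fun t : nat_trans _ _ => t X) b'b.
have {}bb' X : b X ∘ b' X = idm _ := congr1 (fun t : nat_trans _ _ => t X) bb'.
unshelve eexists.
  unshelve refine (@NatTrans C C (functor_comp (functor_comp G1 G2)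
    (functor_comp F2 F1)) (functor_id C) (fun X => a X ∘ fmap G1 (b (F1 X))) _).
  move=> X Y f /=; rewrite -compA -fmap_comp.
  have /= -> := naturality b (fmap F1 f).
  by rewrite fmap_comp !compA; congr (_ ∘ _); exact: (naturality a).
unshelve eexists.
  unshelve refine (@NatTrans C C (functor_id C) (functor_comp
    (functor_comp G1 G2) (functor_comp F2 F1))
    (fun X => fmap G1 (b' (F1 X)) ∘ a' X) _).
  move=> X Y f /=; rewrite -compA.
  have /= -> := naturality a' f.
  by rewrite !compA -!fmap_comp; congr (fmap G1 _ ∘ _); exact: (naturality b').
split; apply: nat_trans_ext => X /=.
  rewrite -compA (compA (a' X)) a'a comp_idl.
  by rewrite -fmap_comp b'b fmap_id.
by rewrite -compA (compA (fmap G1 (b _))) -fmap_comp bb' fmap_id comp_idl aa'.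
Qed.
End Whisker.

Lemma equivalent_trans (C D E : category) :
  equivalent C D -> equivalent D E -> equivalent C E.
Proof.
case=> F1 [G1 [GF1 FG1]] [F2 [G2 [GF2 FG2]]].
by exists (functor_comp F2 F1), (functor_comp G1 G2); split; exact: retract_comp.
Qed.

(** The inverse functor comes from choosing preimages of objects and of morphisms; faithfulness
    reduces each required equation in [C] to one between images under [F]. *)
Lemma weak_equiv_equivalent (C D : category) (F : functor C D) :
  weak_equiv F -> equivalent C D.
Proof.
move=> [fullF faithF esF].
have pre X Y (g : hom (F X) (F Y)) : {f | fmap F f = g} by exact: cid.
have obj Y : {X & {e : hom (F X) Y & {e' : hom Y (F X) |
    e' ∘ e = idm _ /\ e ∘ e' = idm _}}}.
  have [X /cid[e /cid[e' ee]]] := cid (esF Y).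
  by exists X, e, e'.
pose g0 Y := projT1 (obj Y).
pose e Y : hom (F (g0 Y)) Y := projT1 (projT2 (obj Y)).
pose e' Y : hom Y (F (g0 Y)) := sval (projT2 (projT2 (obj Y))).
have e'e Y : e' Y ∘ e Y = idm _ by case: (svalP (projT2 (projT2 (obj Y)))).
have ee' Y : e Y ∘ e' Y = idm _ by case: (svalP (projT2 (projT2 (obj Y)))).
(* Conjugating by the chosen isomorphisms between [F (g0 Y)] and [Y] is what makes [e] natural. *)
pose g1 Y Z (h : hom Y Z) := sval (pre _ _ (e' Z ∘ h ∘ e Y)).
have g1P Y Z (h : hom Y Z) : fmap F (g1 Y Z h) = e' Z ∘ h ∘ e Y.
  exact: svalP (pre _ _ _).
have g1_id Y : g1 Y Y (idm Y) = idm _.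
  by apply: faithF; rewrite g1P fmap_id comp_idr e'e.
have g1_comp X Y Z (h : hom Y Z) (k : hom X Y) :
    g1 X Z (h ∘ k) = g1 Y Z h ∘ g1 X Y k.
  apply: faithF; rewrite fmap_comp !g1P !compA.
  by rewrite -[in RHS](compA _ (e Y)) ee' comp_idr.
pose G := @Functor D C g0 g1 g1_id g1_comp.
have preP X Y g : fmap F (sval (pre X Y g)) = g by exact: svalP (pre X Y g).
exists F, G; split.
  (* On the [C] side the isomorphism is the preimage under [F] of [e] at the objects [F X]. *)
  unshelve eexists (@NatTrans C C (functor_comp G F) (functor_id C)
    (fun X => sval (pre _ _ (e (F X)))) _).
    move=> X Y f /=; apply: faithF; rewrite !fmap_comp !preP.
    by rewrite !compA ee' comp_idl.
  unshelve eexists (@NatTrans C C (functor_id C) (functor_comp G F)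
    (fun X => sval (pre _ _ (e' (F X)))) _).
    move=> X Y f /=; apply: faithF; rewrite !fmap_comp !preP.
    by rewrite -!compA ee' comp_idr.
  by split; apply: nat_trans_ext => X /=; apply: faithF;
    rewrite fmap_comp !preP ?e'e ?ee' fmap_id.
unshelve eexists (@NatTrans D D (functor_comp F G) (functor_id D) e _).
  by move=> X Y f /=; rewrite g1P !compA ee' comp_idl.
unshelve eexists (@NatTrans D D (functor_id D) (functor_comp F G) e' _).
  by move=> X Y f /=; rewrite g1P -!compA ee' comp_idr.
by split; apply: nat_trans_ext => X /=.
Qed.

(** * Restriction of a weak equivalence to wide subcategories *)

Section WideRestriction.
Variables (C D : category) (F : functor C D).
Variables (V : forall X Y : C, hom X Y -> Prop).
Variables (W : forall X Y : D, hom X Y -> Prop).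
Hypothesis V_id : forall X, V (idm X).
Hypothesis V_comp : forall X Y Z (g : hom Y Z) (f : hom X Y),
  V g -> V f -> V (g ∘ f).
Hypothesis W_id : forall X, W (idm X).
Hypothesis W_comp : forall X Y Z (g : hom Y Z) (f : hom X Y),
  W g -> W f -> W (g ∘ f).
Hypothesis VW : forall X Y (f : hom X Y), V f <-> W (fmap F f).
Hypothesis W_iso : forall X Y (f : hom X Y), is_iso f -> W f.

Definition wide_functor : functor (wide_sub V_id V_comp) (wide_sub W_id W_comp).
Proof.
refine (@Functor (wide_sub V_id V_comp) (wide_sub W_id W_comp) F
  (fun X Y f => exist _ (fmap F (sval f)) (iffLR (VW (sval f)) (svalP f))) _ _).
  by move=> X; apply: eq_exist; exact: fmap_id.
by move=> X Y Z g f; apply: eq_exist; exact: fmap_comp.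
Defined.

(** [W_iso] serves essential surjectivity: the isomorphism from [F X] to [Y] and its inverse must
    both lie in [W]. Fullness uses that [F] reflects membership. *)
Lemma wide_functor_weak_equiv : weak_equiv F -> weak_equiv wide_functor.
Proof.
move=> [fullF faithF esF]; split=> [X Y [g Wg]|X Y [f Vf] [g Vg] [/faithF e]|Y].
- have [f e] := fullF _ _ g.
  have Vf : V f by apply/VW; rewrite e.
  by exists (exist _ f Vf); apply: eq_exist.
- exact: eq_exist.
have [X [f [g [gf fg]]]] := esF Y; exists X.
have Wf : W f by apply: W_iso; exists g.
have Wg : W g by apply: W_iso; exists f.
by exists (exist _ f Wf), (exist _ g Wg); split; apply: eq_exist.
Qed.
End WideRestriction.

(** * Families of objects and their maps *)

Record family (T : Type) := Family { index : finType; member : index -> T }.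
Arguments Family {T} index member.

Section Fam.
Variable C : category.

(* Maps are contravariant on members, as for the objects representing the
   summands of a sum; reindexing data and map are bundled in one dependent
   pair, so that composition needs no transport. *)
Definition fam_hom (c d : family C) : Type :=
  forall i : index c, {j : index d & hom (member j) (member i)}.

Definition fam_id (c : family C) : fam_hom c c :=
  fun i => existT _ i (idm (member i)).

Definition fam_comp (b c d : family C) (g : fam_hom c d) (f : fam_hom b c) :
    fam_hom b d :=
  fun i => existT _ (projT1 (g (projT1 (f i))))
             (projT2 (f i) ∘ projT2 (g (projT1 (f i)))).

Program Definition Fam : category :=
  @Category (family C) fam_hom fam_id fam_comp _ _ _.
Next Obligation.
move=> c d f; apply: functional_extensionality_dep => i.
by rewrite /fam_comp /= comp_idr; case: (f i).
Qed.
Next Obligation.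
move=> c d f; apply: functional_extensionality_dep => i.
by rewrite /fam_comp /= comp_idl; case: (f i).
Qed.
Next Obligation.
move=> a b c d h g f; apply: functional_extensionality_dep => i.
by rewrite /fam_comp /= compA.
Qed.

Definition fam_iso (c d : Fam) (f : hom c d) : Prop :=
  forall i, is_iso (projT2 (f i)).

Lemma is_iso_id (X : C) : is_iso (idm X).
Proof. by exists (idm X); rewrite comp_idl. Qed.

Lemma is_iso_comp (X Y Z : C) (g : hom Y Z) (f : hom X Y) :
  is_iso g -> is_iso f -> is_iso (g ∘ f).
Proof.
case=> g' [gg' g'g] [f' [ff' f'f]]; exists (f' ∘ g'); split.
  by rewrite -compA (compA g') gg' comp_idl.
by rewrite -compA (compA f) f'f comp_idl.
Qed.

Lemma fam_iso_id (c : Fam) : fam_iso (idm c).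
Proof. by move=> i; exact: is_iso_id. Qed.

Lemma fam_iso_comp (b c d : Fam) (g : hom c d) (f : hom b c) :
  fam_iso g -> fam_iso f -> fam_iso (g ∘ f).
Proof. by move=> gi fi i; exact: is_iso_comp (fi i) (gi _). Qed.

Definition FamIso : category := wide_sub fam_iso_id fam_iso_comp.

Lemma isomorphic_members (I : finType) (c d : I -> C) :
  (forall i, isomorphic (c i) (d i)) ->
  @isomorphic Fam (Family I c) (Family I d).
Proof.
move=> cd.
have e i : {f : hom (d i) (c i) & {g : hom (c i) (d i) |
    g ∘ f = idm _ /\ f ∘ g = idm _}}.
  by have /cid[g /cid[f [fg gf]]] := cd i; exists f, g.
exists (fun i => existT _ i (projT1 (e i))).
exists (fun i => existT _ i (sval (projT2 (e i)))).
split; apply: functional_extensionality_dep => i;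
  by rewrite /= /fam_comp /=; case: (e i) => f [g /= [gf fg]]; rewrite ?gf ?fg.
Qed.

End Fam.

(* [eq_from_Tagged] is not applicable to the hom types of a category, whose
   universe is too large for it. *)
Lemma existT_inj (I : eqType) (P : I -> Type) (i : I) (u v : P i) :
  existT P i u = existT P i v -> u = v.
Proof.
move=> /(congr1 (fun w => if projT1 w =P i is ReflectT e
                          then eq_rect _ P (projT2 w) _ e else u)) /=.
by case: (i =P i) => // e; rewrite eq_axiomK.
Qed.

(** * Exchanging a category with its opposite on families with invertible maps *)

Section FamIsoOp.
Variable C : category.

Lemma is_iso_op (X Y : C) (f : hom X Y) : is_iso f -> @is_iso (op C) Y X f.
Proof. by case=> g [gf fg]; exists g. Qed.

Lemma is_iso_inv (X Y : C) (f : hom X Y) :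
  is_iso f -> {g : hom Y X | g ∘ f = idm X /\ f ∘ g = idm Y}.
Proof. exact: cid. Qed.

Lemma inv_unique (X Y : C) (f : hom X Y) (g h : hom Y X) :
  g ∘ f = idm X -> f ∘ h = idm Y -> g = h.
Proof. by move=> gf fh; rewrite -(comp_idr g) -fh compA gf comp_idl. Qed.

Definition isoinv (X Y : C) (f : hom X Y) (fi : is_iso f) : hom Y X :=
  sval (is_iso_inv fi).

Lemma isoinvK (X Y : C) (f : hom X Y) (fi : is_iso f) : isoinv fi ∘ f = idm X.
Proof. by case: (svalP (is_iso_inv fi)). Qed.

Lemma isoinvKr (X Y : C) (f : hom X Y) (fi : is_iso f) : f ∘ isoinv fi = idm Y.
Proof. by case: (svalP (is_iso_inv fi)). Qed.

Lemma isoinv_is_iso (X Y : C) (f : hom X Y) (fi : is_iso f) :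
  is_iso (isoinv fi).
Proof. by exists f; rewrite isoinvK isoinvKr. Qed.

Definition flip_hom (c d : FamIso C) (f : hom c d) :
    @hom (FamIso (op C)) c d :=
  exist (@fam_iso (op C) c d)
    (fun i => existT (fun j => @hom (op C) (member j) (member i))
                      (projT1 (sval f i)) (isoinv (svalP f i)))
    (fun i => is_iso_op (isoinv_is_iso (svalP f i))).

Definition flip : functor (FamIso C) (FamIso (op C)).
Proof.
refine (@Functor (FamIso C) (FamIso (op C)) (fun c => c) flip_hom _ _).
  move=> c; apply: eq_exist; apply: functional_extensionality_dep => i /=.
  congr existT; apply: (@inv_unique _ _ (idm _)); last exact: comp_idl.
  exact: isoinvK.
move=> b c d [g gi] [f fi]; apply: eq_exist.
apply: functional_extensionality_dep => i /=.
congr existT; apply: inv_unique; first exact: isoinvK.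
by rewrite /= -compA (compA (projT2 (g _))) isoinvKr comp_idl isoinvKr.
Defined.

(** Faithful, since a map is determined by its inverse; full, since inverting the member maps of a
    morphism over [op C] yields a preimage. *)
Lemma flip_weak_equiv : weak_equiv flip.
Proof.
split=> [c d [g gi]|c d f g /(congr1 sval) fg|c]; last first.
- by exists c, (idm c), (idm c); split; exact: comp_idl.
- suff : sval f = sval g.
    by case: f g {fg} => [f fi] [g gi] /= fg; exact: eq_exist.
  apply: functional_extensionality_dep => i.
  move: (congr1 (fun h => h i) fg) => /=.
  move: (svalP f i) (svalP g i).
  case: (sval f i) (sval g i) => [j u] [k v] /= ui vi e.
  have jk : j = k := congr1 (@projT1 _ _) e; subst k.
  have {}e := existT_inj e.
  congr existT; apply: (@inv_unique _ _ (isoinv ui)); first exact: isoinvKr.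
  by rewrite e isoinvK.
have gi' i : @is_iso C _ _ (projT2 (g i)).
  by have [h [hg gh]] := gi i; exists h.
unshelve eexists.
  exists (fun i => existT (fun j => @hom C (member j) (member i))
                     (projT1 (g i)) (isoinv (gi' i))).
  by move=> i; exact: isoinv_is_iso.
apply: eq_exist; apply: functional_extensionality_dep => i /=.
rewrite [RHS]sigT_eta; congr existT.
apply: inv_unique; first exact: isoinvK.
exact: isoinvK.
Qed.
End FamIsoOp.

(** * Pullbacks of finite sets and cartesian transformations *)

Lemma Fin_comp_appE (X Y Z : finType) (g : @hom Fin Y Z) (f : @hom Fin X Y) x :
  ((g ∘ f : @hom Fin X Z) : {ffun X -> Z}) x =
  (g : {ffun Y -> Z}) ((f : {ffun X -> Y}) x).
Proof. by rewrite /= ffunE. Qed.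

(** Maps out of [unit] are elements, so testing the universal property there gives the elementwise
    condition; conversely, choice assembles the unique elements into a mediating map. *)
Lemma Fin_pullbackP (W A B Z : finType) (p : {ffun W -> A}) (q : {ffun W -> B})
    (f : {ffun A -> Z}) (g : {ffun B -> Z}) :
  (forall w, f (p w) = g (q w)) ->
  @is_pullback Fin W A B Z p q f g <->
  (forall a b, f a = g b -> exists! w, p w = a /\ q w = b).
Proof.
move=> comm; split=> [[_ pb] a b e|pb].
  have e1 : @comp Fin unit A Z f [ffun=> a] = @comp Fin unit B Z g [ffun=> b].
    by apply/ffunP => t; rewrite /= !ffunE.
  have [h [[/ffunP ph /ffunP qh] uniq]] := pb unit [ffun=> a] [ffun=> b] e1.
  exists ((h : {ffun _ -> _}) tt); split.
    by move: (ph tt) (qh tt); rewrite /= !ffunE.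
  move=> w [pw qw].
  have /ffunP/(_ tt) : h = [ffun=> w]; last by rewrite ffunE.
  by apply: uniq; split; apply/ffunP => t; rewrite /= !ffunE.
split=> [|V a b /ffunP e]; first by apply/ffunP => w; rewrite /= !ffunE.
have /choice[h hP] (v : (V : finType)) : exists w,
    (p w = (a : {ffun _ -> _}) v /\ q w = (b : {ffun _ -> _}) v) /\
    forall w', p w' = (a : {ffun _ -> _}) v /\ q w' = (b : {ffun _ -> _}) v ->
      w = w'.
  by apply: pb; have := e v; rewrite /= !ffunE.
exists [ffun v => h v]; split.
  by split; apply/ffunP => v; rewrite /= !ffunE; have [[]] := hP v.
move=> k [/ffunP pk /ffunP qk]; apply/ffunP => v; rewrite ffunE.
have [_] := hP v; apply; split.
  by have := pk v; rewrite /= !ffunE.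
by have := qk v; rewrite /= !ffunE.
Qed.

(** A commuting square with two parallel invertible sides is a pullback; inverting [a X] forces the
    mediating map. *)
Lemma nat_iso_cartesian (C D : category) (F G : functor C D)
    (a : nat_trans F G) : @is_iso (functors C D) _ _ a -> cartesian a.
Proof.
case=> b [ba ab] X Y f; split=> [|V u v e]; first exact: naturality.
have {}ba Z : b Z ∘ a Z = idm _ := congr1 (fun t : nat_trans _ _ => t Z) ba.
have {}ab Z : a Z ∘ b Z = idm _ := congr1 (fun t : nat_trans _ _ => t Z) ab.
exists (b X ∘ v); split=> [|h [_ <-]]; last by rewrite compA ba comp_idl.
by rewrite !compA -naturality -compA -e compA ba ab !comp_idl.
Qed.

(** * Sums of representables over a category with a terminal object *)

Section Sums.
Variables (C : category) (R : C -> functor C Fin).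
(* [R k] is the functor [hom k -]; [rep] and [unrep] stand for the identity,
   which cannot be stated since [hom k X] is not a finite type in general. *)
Variable rep : forall k X : C, hom k X -> (R k X : finType).
Variable unrep : forall k X : C, (R k X : finType) -> hom k X.
Hypothesis repK : forall k X (f : hom k X), unrep (rep f) = f.
Hypothesis unrepK : forall k X (x : (R k X : finType)), rep (unrep x) = x.
Hypothesis rep_natural : forall (k X Y : C) (f : hom X Y) (h : hom k X),
  (fmap (R k) f : {ffun _ -> _}) (rep h) = rep (f ∘ h).
Variables (T : C) (bang : forall X, hom X T).
Hypothesis bang_unique : forall X (f : hom X T), f = bang X.

(** Indexing by [P T] makes this convertible to [is_polynomial] at [T = unit] and to [is_dirichlet]
    at [T = void]. *)
Definition is_sum (P : functor C Fin) : Prop :=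
  exists p : (P T : finType) -> C,
    @isomorphic (functors C Fin) P (functor_sum (fun i => R (p i))).

Definition sum_functor (c : Fam C) : functor C Fin :=
  functor_sum (fun i => R (member (f := c) i)).

(** Writing elements of the sum through maps of [C] turns later computations into composition in
    [C]. *)
Definition sum_pt (c : Fam C) (X : C) (i : index c) (h : hom (member i) X) :
    (sum_functor c X : finType) :=
  Tagged (fun i => (R (member (f := c) i) X : finType)) (rep h).

Lemma sum_ptP (c : Fam C) (X : C) (z : (sum_functor c X : finType)) :
  {i & {h | z = @sum_pt c X i h}}.
Proof. by case: z => i x; exists i, (unrep x); rewrite /sum_pt unrepK. Qed.

Lemma sum_pt_inj (c : Fam C) (X : C) (i : index c) (g h : hom (member i) X) :
  sum_pt g = sum_pt h -> g = h.
Proof.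
by move=> e; rewrite -(repK g) -(repK h); congr unrep; exact: existT_inj e.
Qed.

Lemma fmap_sum_pt (c : Fam C) (X Y : C) (f : hom X Y) (i : index c)
    (h : hom (member i) X) :
  (fmap (sum_functor c) f : {ffun _ -> _}) (sum_pt h) = sum_pt (f ∘ h).
Proof. by rewrite /sum_pt /= ffunE /= rep_natural. Qed.

Definition sum_map_at (c d : Fam C) (f : hom c d) (X : C) :
    hom (sum_functor c X) (sum_functor d X) :=
  [ffun z : {i : index c & (R (member i) X : finType)} =>
     sum_pt (unrep (tagged z) ∘ projT2 (f (tag z)))].

Lemma sum_map_pt (c d : Fam C) (f : hom c d) (X : C) (i : index c)
    (h : hom (member i) X) :
  (sum_map_at f X : {ffun _ -> _}) (sum_pt h) = sum_pt (h ∘ projT2 (f i)).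
Proof. by rewrite ffunE /= repK. Qed.

Lemma sum_map_natural (c d : Fam C) (f : hom c d) (X Y : C) (g : hom X Y) :
  sum_map_at f Y ∘ fmap (sum_functor c) g =
  fmap (sum_functor d) g ∘ sum_map_at f X.
Proof.
apply/ffunP => z; rewrite !Fin_comp_appE; have [i [h ->]] := sum_ptP z.
by rewrite sum_map_pt !fmap_sum_pt sum_map_pt compA.
Qed.

Definition sum_map (c d : Fam C) (f : hom c d) :
    nat_trans (sum_functor c) (sum_functor d) :=
  NatTrans (sum_map_natural f).

Definition sums : functor (Fam C) (functors C Fin).
Proof.
refine (@Functor (Fam C) (functors C Fin) sum_functor sum_map _ _).
  move=> c; apply: nat_trans_ext => X; apply/ffunP => z.
  have [i [h ->]] := sum_ptP z.
  by rewrite [LHS]sum_map_pt /= comp_idr ffunE.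
move=> b c d g f; apply: nat_trans_ext => X; apply/ffunP => z.
have [i [h ->]] := sum_ptP z.
by rewrite Fin_comp_appE !sum_map_pt /= compA.
Defined.

(** Each member has exactly one map to [T], so an element of the sum at [T] amounts to an index.
    This supplies the indexing by [P T] that [is_sum] demands. *)
Lemma sum_index (c : Fam C) :
  @isomorphic (Fam C) c
    (Family (sum_functor c T : finType) (fun z => member (tag z))).
Proof.
pose f : @hom (Fam C) c
    (Family (sum_functor c T : finType) (fun z => member (tag z))) :=
  fun i => existT _ (sum_pt (bang (member i))) (idm (member i)).
pose g : @hom (Fam C)
    (Family (sum_functor c T : finType) (fun z => member (tag z))) c :=
  fun z => existT _ (tag z) (idm (member (tag z))).
exists f, g; split; apply: functional_extensionality_dep => i.
  by rewrite /= /fam_comp /= comp_idl.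
rewrite /= /fam_comp /= comp_idl /fam_id.
by have [j [h ->]] := sum_ptP i; rewrite /= [h]bang_unique.
Qed.

Lemma sum_functor_is_sum (c : Fam C) : is_sum (sum_functor c).
Proof.
exists (fun z => member (tag z)).
exact: (functor_isomorphic sums (sum_index c)).
Qed.

Definition sums_in : functor (Fam C) (full_sub (C := functors C Fin) is_sum).
Proof.
refine (@Functor (Fam C) (full_sub (C := functors C Fin) is_sum)
  (fun c => exist is_sum (sum_functor c) (sum_functor_is_sum c)) sum_map _ _).
  exact: (fmap_id sums).
exact: (fmap_comp sums).
Defined.

(** Full faithfulness is Yoneda: a transformation is determined by its values at the identities of
    the members. Essential surjectivity unfolds [is_sum]. *)
Lemma sums_in_weak_equiv : weak_equiv sums_in.
Proof.
split=> [c d a|c d f g fg|[P Psum]].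
- pose u i := sum_ptP
    ((component a (member i) : {ffun _ -> _}) (sum_pt (idm (member (f := c) i)))).
  exists (fun i => existT _ (projT1 (u i)) (sval (projT2 (u i)))).
  apply: nat_trans_ext => X; apply/ffunP => z.
  have [i [h ->]] := sum_ptP z; rewrite [LHS]sum_map_pt /=.
  (* [sum_pt h] is the image of the identity point under [h], so naturality of [a] along [h]
     determines its value there. *)
  rewrite -fmap_sum_pt -(svalP (projT2 (u i))).
  have /ffunP/(_ (sum_pt (idm (member i)))) := naturality a h.
  by rewrite !Fin_comp_appE [X in _ _ X = _]fmap_sum_pt comp_idr => ->.
- apply: functional_extensionality_dep => i.
  have /ffunP/(_ (sum_pt (idm (member i)))) :=
    congr1 (fun a : nat_trans _ _ => a (member i)) fg.
  rewrite [LHS]sum_map_pt [RHS]sum_map_pt !comp_idl.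
  case: (f i) (g i) => [j u] [k v] /= e.
  have jk : j = k := congr1 (@projT1 _ _) e; subst k.
  by rewrite (sum_pt_inj e).
have [p Pp] := Psum.
exists (Family (P T : finType) p).
case: Pp => [a [b [ba ab]]]; exists b, a; split; [exact: ab|exact: ba].
Qed.

Lemma sum_map_cartesian (c d : Fam C) (f : hom c d) :
  fam_iso f <-> cartesian (sum_map f).
Proof.
have pbP X Y (g : hom X Y) := Fin_pullbackP
  (p := fmap (sum_functor c) g) (q := sum_map f X)
  (f := sum_map f Y) (g := fmap (sum_functor d) g).
have comm X Y (g : hom X Y) w :
    (sum_map f Y : {ffun _ -> _}) ((fmap (sum_functor c) g : {ffun _ -> _}) w) =
    (fmap (sum_functor d) g : {ffun _ -> _}) ((sum_map f X : {ffun _ -> _}) w).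
  by have /ffunP/(_ w) := naturality (sum_map f) g; rewrite !Fin_comp_appE.
split=> [fi X Y g|cart i].
  apply/(pbP _ _ _ (comm _ _ _)) => a b.
  have [i [h ->]] := sum_ptP a; have [j [k ->]] := sum_ptP b.
  rewrite [LHS]sum_map_pt fmap_sum_pt.
  (* The computation rule is specialized before [f i] is destructed, so that it then speaks of the
     index and the map separately. *)
  have fE Z l := @sum_map_pt c d f Z i l; move: (fi i) fE.
  case: (f i) => j' u /= [v [vu uv]] fE e.
  have jj : j' = j := congr1 (@projT1 _ _) e; subst j'.
  have {}e := sum_pt_inj e.
  (* A lift must give [k] when composed with [u], which forces [k ∘ v] for the inverse [v] of
     [u]. *)
  exists (sum_pt (k ∘ v)); split.
    split; first by rewrite fmap_sum_pt compA -e -compA uv comp_idr.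
    by rewrite [LHS]fE -compA vu comp_idr.
  move=> w [] ; have [i' [l ->]] := sum_ptP w; rewrite fmap_sum_pt => e'.
  have ii : i' = i := congr1 (@projT1 _ _) e'; subst i'.
  rewrite [X in X = _ -> _]fE => /sum_pt_inj <-.
  by rewrite -compA uv comp_idr.
have fE Z l := @sum_map_pt c d f Z i l; move: fE.
case: (f i) => j g /= fE.
(* The pullback over [bang (member j)] is tested on the identity of [member j]; the element it
   yields is a left inverse [w] of [g]. *)
have compat : (sum_map f T : {ffun _ -> _}) (sum_pt (bang (member i))) =
    (fmap (sum_functor d) (bang (member j)) : {ffun _ -> _})
      (sum_pt (idm (member j))).
  rewrite [LHS]fE fmap_sum_pt; congr sum_pt.
  by rewrite [LHS]bang_unique comp_idr.
have /(pbP _ _ _ (comm _ _ _)) pb := cart (member j) T (bang _).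
have [z [[]]] := pb _ _ compat.
have [i' [w ->]] := sum_ptP z; rewrite fmap_sum_pt => e.
have ii : i' = i := congr1 (@projT1 _ _) e; subst i'.
rewrite [X in X = _ -> _]fE => /sum_pt_inj wg _.
exists w; split=> //.
(* In the pullback over [bang (member i)], the points of [g ∘ w] and of the identity both lift that
   of [g]; uniqueness makes [w] a right inverse too. *)
have /(pbP _ _ _ (comm _ _ _)) {}pb := cart (member i) T (bang _).
have compat' : (sum_map f T : {ffun _ -> _}) (sum_pt (bang (member i))) =
    (fmap (sum_functor d) (bang (member i)) : {ffun _ -> _}) (sum_pt g).
  by rewrite [LHS]fE fmap_sum_pt.
have [y [_ y_unique]] := pb _ _ compat'.
apply: (@sum_pt_inj c); transitivity y; [apply/esym|]; apply: y_unique.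
  rewrite fmap_sum_pt [X in _ /\ X = _]fE; split; congr sum_pt.
    exact: bang_unique.
  by rewrite -compA wg comp_idr.
rewrite fmap_sum_pt [X in _ /\ X = _]fE; split; congr sum_pt.
  exact: bang_unique.
exact: comp_idl.
Qed.

Lemma sums_in_cartesian (c d : Fam C) (f : hom c d) :
  fam_iso f <-> cartesian (fmap sums_in f).
Proof. exact: sum_map_cartesian. Qed.
End Sums.

(** * Polynomial and Dirichlet functors as families *)

Lemma corep_natural (k X Y : Fin) (f : hom X Y) (h : hom k X) :
  (fmap (corepresentable k) f : {ffun {ffun k -> X} -> {ffun k -> Y}}) h = f ∘ h.
Proof. by rewrite ffunE. Qed.

Lemma rep_natural (k X Y : op Fin) (f : hom X Y) (h : hom k X) :
  (fmap (representable k) f : {ffun {ffun X -> k} -> {ffun Y -> k}}) h = f ∘ h.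
Proof. by rewrite ffunE. Qed.

Definition unit_bang (X : Fin) : @hom Fin X unit := [ffun=> tt].

Lemma unit_bang_unique (X : Fin) (f : @hom Fin X unit) : f = unit_bang X.
Proof. by apply/ffunP => x; case: (f x); rewrite ffunE. Qed.

Definition void_bang (X : op Fin) : @hom (op Fin) X void :=
  [ffun z : void => match z with end].

Lemma void_bang_unique (X : op Fin) (f : @hom (op Fin) X void) : f = void_bang X.
Proof. by apply: (iffLR (@ffunP void _ _ _)) => -[]. Qed.

Definition fam_poly : functor (Fam Fin) Poly :=
  sums_in (C := Fin) (R := corepresentable)
    (rep := fun k X h => h) (unrep := fun k X h => h)
    (fun _ _ _ => erefl) (fun _ _ _ => erefl) corep_natural unit_bang_unique.

Definition fam_dir : functor (Fam (op Fin)) Dir :=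
  sums_in (C := op Fin) (R := representable)
    (rep := fun k X h => h) (unrep := fun k X h => h)
    (fun _ _ _ => erefl) (fun _ _ _ => erefl) rep_natural void_bang_unique.

Lemma fam_poly_weak_equiv : weak_equiv fam_poly.
Proof. exact: sums_in_weak_equiv. Qed.

Lemma fam_dir_weak_equiv : weak_equiv fam_dir.
Proof. exact: sums_in_weak_equiv. Qed.

Lemma cartesian_equivalent (C : category) (P : functor C Fin -> Prop)
    (F : functor (Fam C) (full_sub (C := functors C Fin) P)) :
  weak_equiv F ->
  (forall c d (f : hom c d), fam_iso f <-> cartesian (fmap F f)) ->
  equivalent (FamIso C) (cartesian_sub P).
Proof.
move=> Feq Fcart.
apply: weak_equiv_equivalent (wide_functor_weak_equiv
  (@fam_iso_id C) (@fam_iso_comp C) _ _ Fcart _ Feq).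
by move=> X Y f fi; exact: nat_iso_cartesian.
Qed.

Lemma FamIso_Poly_cart : equivalent (FamIso Fin) Poly_cart.
Proof.
apply: (cartesian_equivalent fam_poly_weak_equiv) => c d f.
exact: sums_in_cartesian.
Qed.

Lemma FamIso_Dir_cart : equivalent (FamIso (op Fin)) Dir_cart.
Proof.
apply: (cartesian_equivalent fam_dir_weak_equiv) => c d f.
exact: sums_in_cartesian.
Qed.

(** As [flip] fixes families, the equivalence built here matches, up to isomorphism, the sum of the
    [y^(p_i)] with the sum of the [(p_i)^y]. *)
Lemma Poly_cart_Dir_cart : equivalent Poly_cart Dir_cart.
Proof.
apply: equivalent_trans (equivalent_sym FamIso_Poly_cart) _.
apply: equivalent_trans FamIso_Dir_cart.
exact: weak_equiv_equivalent (flip_weak_equiv Fin).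
Qed.

(** * Bundles as families of fibers *)

Section Fibers.
Variable p : bundle.

Definition fiber (i : base p) : finType := {x : total p | proj p x == i}.

Lemma fiberP (i : base p) (x : fiber i) : proj p (val x) = i.
Proof. exact/eqP/(valP x). Qed.

Definition fiber_mk (x : total p) (i : base p) (e : proj p x = i) : fiber i :=
  exist _ x (introT eqP e).
End Fibers.

Definition fibers (p : bundle) : family finType := Family (base p) (@fiber p).

(** Gives essential surjectivity of both fiber functors: the inclusion of a summand is a bijection
    onto the fiber over its index. *)
Lemma fiber_tag (I : finType) (c : I -> finType) (i : I) :
  @isomorphic Fin
    (@fiber (Bundle [ffun z : {i : I & c i} => tag z]) i) (c i).
Proof.
pose p := Bundle [ffun z : {i : I & c i} => tag z].
have pE (x : c i) : proj p (Tagged c x) = i by rewrite ffunE.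
have [f fE] : exists f : {ffun c i -> fiber (p := p) i},
    forall x, f x = fiber_mk (pE x).
  by exists [ffun x => fiber_mk (pE x)] => x; rewrite ffunE.
have f_inj : injective f.
  by move=> x y; rewrite !fE => e; exact: (existT_inj (congr1 val e)).
have /choice[g gP] (z : fiber (p := p) i) : exists x, f x = z.
  case: z => -[j x] e; have ij : j = i by rewrite -(eqP e) ffunE.
  by subst j; exists x; rewrite fE; apply: val_inj.
exists [ffun z => g z], f; split; apply/ffunP => x; rewrite [LHS]ffunE [RHS]ffunE.
  by rewrite [X in f X]ffunE gP.
by rewrite ffunE; apply: f_inj; rewrite gP.
Qed.

(** The indices may be equal without being convertible; comparing points of fibers inside the total
    space avoids a transport. This serves containers, and [fiber_codom_eq] serves bundles. *)
Lemma fiber_dom_eq (q : bundle) (A : finType) (i j : base q)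
    (g : {ffun fiber i -> A}) (h : {ffun fiber j -> A}) :
  i = j -> (forall a b, val a = val b -> g a = h b) ->
  existT (fun k => {ffun fiber k -> A}) i g =
  existT (fun k => {ffun fiber k -> A}) j h.
Proof.
by move=> ij; subst j => gh; congr existT; apply/ffunP => a; exact: gh.
Qed.

Lemma fiber_dom_inj (q : bundle) (A : finType) (i j : base q)
    (g : {ffun fiber i -> A}) (h : {ffun fiber j -> A}) :
  existT (fun k => {ffun fiber k -> A}) i g =
  existT (fun k => {ffun fiber k -> A}) j h ->
  forall a b, val a = val b -> g a = h b.
Proof.
move=> e; have ij : i = j := congr1 (@projT1 _ _) e; subst j.
by move=> a b /val_inj ->; rewrite (existT_inj e).
Qed.

Lemma fiber_codom_eq (q : bundle) (A : finType) (i j : base q)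
    (g : {ffun A -> fiber i}) (h : {ffun A -> fiber j}) :
  i = j -> (forall a, val (g a) = val (h a)) ->
  existT (fun k => {ffun A -> fiber k}) i g =
  existT (fun k => {ffun A -> fiber k}) j h.
Proof.
move=> ij; subst j => gh; congr existT; apply/ffunP => a.
exact/val_inj/gh.
Qed.

Lemma cont_fiber_eq (p q : bundle) (f : cont_hom p q) (i : base p)
    (b : fiber (cont_base f i)) : cont_base f i = proj q (val b).
Proof. by rewrite fiberP. Qed.

Definition cont_fibers_hom (p q : Cont) (f : hom p q) :
    @hom (Fam Fin) (fibers p) (fibers q) :=
  fun i => existT (fun j => {ffun fiber j -> fiber i}) (cont_base f i)
    [ffun b => fiber_mk (proj_cont_fun (cont_fiber_eq b))].

Lemma bun_fiber_eq (p q : bundle) (f : bun_hom p q) (i : base p)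
    (a : fiber i) : proj q (bun_fun f (val a)) = bun_base f i.
Proof. by rewrite /bun_fun -fp_eq bun_fst fiberP. Qed.

Definition bun_fibers_hom (p q : Bun) (f : hom p q) :
    @hom (Fam (op Fin)) (fibers p) (fibers q) :=
  fun i => existT (fun j => {ffun fiber i -> fiber j}) (bun_base f i)
    [ffun a => fiber_mk (bun_fiber_eq f a)].

Definition cont_fibers : functor Cont (Fam Fin).
Proof.
refine (@Functor Cont (Fam Fin) fibers cont_fibers_hom _ _).
  move=> p; apply: functional_extensionality_dep => i.
  apply: fiber_dom_eq => [|a b ab]; first by rewrite ffunE.
  by rewrite !ffunE; apply: val_inj; rewrite /= cont_fun_id [X in _ = sval X]ffunE.
move=> p q r g f; apply: functional_extensionality_dep => i.
apply: fiber_dom_eq => [|a b ab]; first by rewrite ffunE.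
rewrite !ffunE; apply: val_inj => /=.
(* [cont_fun_comp] needs the two lifts separately: [eg] lifts through [g], and [ef] lifts the result
   through [f]. *)
have eg : cont_base g (cont_base f i) = proj r (val a) by rewrite ab fiberP.
have ef : cont_base f i = proj q (cont_fun eg) by rewrite proj_cont_fun.
rewrite (cont_fun_comp _ ef) 2![X in _ = sval X]ffunE.
apply: cont_fun_irr => //=.
by rewrite [X in _ = sval X]ffunE; apply: cont_fun_irr.
Defined.

Definition bun_fibers : functor Bun (Fam (op Fin)).
Proof.
refine (@Functor Bun (Fam (op Fin)) fibers bun_fibers_hom _ _).
  move=> p; apply: functional_extensionality_dep => i.
  apply: fiber_codom_eq => [|a]; first by rewrite ffunE.
  by rewrite [X in val X = _]ffunE [X in _ = val X]ffunE /= /bun_fun /= ffunE.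
move=> p q r g f; apply: functional_extensionality_dep => i.
apply: fiber_codom_eq => [|a]; first by rewrite ffunE.
rewrite [X in val X = _]ffunE 2![X in _ = val X]ffunE /= ffunE.
by rewrite /bun_fun /= !ffunE.
Defined.

Lemma cont_fibers_weak_equiv : weak_equiv cont_fibers.
Proof.
split=> [p q u|p q f g fg|[I c]].
- pose f0 : {ffun base p -> base q} := [ffun i => projT1 (u i)].
  have zP (z : fiber_product f0 (proj q)) :
    proj q (fp_snd z) = projT1 (u (fp_fst z)) by rewrite -fp_eq ffunE.
  (* A point of the pullback is an index [i] with a point of [q] over the index that [u] assigns to
     [i], so the fiber maps of [u] glue to one map. *)
  pose f1 : {ffun fiber_product f0 (proj q) -> total p} := [ffun z =>
    val ((projT2 (u (fp_fst z)) : {ffun _ -> _}) (fiber_mk (zP z)))].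
  have f1P : @comp Fin _ _ _ (proj p) f1 = [ffun z => fp_fst z].
    by apply/ffunP => z; rewrite /= !ffunE fiberP.
  exists (@ContHom p q f0 (exist _ f1 f1P)).
  apply: functional_extensionality_dep => i.
  rewrite [RHS]sigT_eta; apply: fiber_dom_eq => [|a b ab]; first by rewrite ffunE.
  apply: val_inj; rewrite !ffunE /= /cont_fun /= ffunE.
  by congr (val ((projT2 (u i) : {ffun _ -> _}) _)); exact: val_inj.
- have fgi i : cont_fibers_hom f i = cont_fibers_hom g i :=
    congr1 (fun h => h i) fg.
  apply: cont_hom_ext => [|a b e e'].
    by apply/ffunP => i; have := congr1 (@projT1 _ _) (fgi i).
  (* [e] and [e'] place [b] in the fibers over the two base values of [a], where the fiber maps of
     [f] and [g] agree. *)
  have := fiber_dom_inj (fgi a)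
    (a := fiber_mk (esym e)) (b := fiber_mk (esym e')) erefl.
  by rewrite !ffunE => /(congr1 val) /=; congr (_ = _); exact: cont_fun_irr.
exists (Bundle [ffun z : {i : I & c i} => tag z]).
apply: (@isomorphic_members Fin) => i; exact: fiber_tag.
Qed.

Lemma bun_fibers_weak_equiv : weak_equiv bun_fibers.
Proof.
split=> [p q u|p q f g fg|[I c]].
- pose f0 : {ffun base p -> base q} := [ffun i => projT1 (u i)].
  (* Each point is moved by the fiber map over its own projection. *)
  pose h (a : total p) : total q :=
    val ((projT2 (u (proj p a)) : {ffun _ -> _}) (fiber_mk (erefl (proj p a)))).
  have hP (a : total p) : f0 (proj p a) = proj q (h a) by rewrite ffunE fiberP.
  pose f1 : {ffun total p -> fiber_product f0 (proj q)} :=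
    [ffun a => fp_mk (hP a)].
  have f1P : @comp Fin _ _ _ [ffun z : fiber_product f0 (proj q) => fp_fst z] f1
      = proj p.
    by apply/ffunP => z; rewrite /= !ffunE.
  exists (@BunHom p q f0 (exist _ f1 f1P)).
  apply: functional_extensionality_dep => i.
  rewrite [RHS]sigT_eta; apply: fiber_codom_eq => [|a]; first by rewrite ffunE.
  rewrite [X in val X = _]ffunE /= /bun_fun /= ffunE fp_snd_mk /h.
  case: a => a e /=; move: (eqP e) => ei; subst i.
  by congr (val ((projT2 (u _) : {ffun _ -> _}) _)); exact: val_inj.
- have fgi i : bun_fibers_hom f i = bun_fibers_hom g i :=
    congr1 (fun h => h i) fg.
  apply: bun_hom_ext => [|a].
    by apply/ffunP => i; have := congr1 (@projT1 _ _) (fgi i).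
  (* [ev] lands in [total q] whatever the index, so the equality of dependent pairs passes through
     it without transport. *)
  pose ev (w : {j & {ffun fiber (proj p a) -> fiber (p := q) j}}) : total q :=
    val (projT2 w (fiber_mk (erefl (proj p a)))).
  by have := congr1 ev (fgi (proj p a)); rewrite /ev /= !ffunE.
exists (Bundle [ffun z : {i : I & c i} => tag z]).
apply: (@isomorphic_members (op Fin)) => i.
have [f [g [gf fg]]] := fiber_tag c i.
by exists g, f.
Qed.

Theorem theorem4p6 :
  equivalent Poly Cont /\ equivalent Dir Bun /\ equivalent Poly_cart Dir_cart.
Proof.
split; last split; last exact: Poly_cart_Dir_cart.
  (* The composite goes from [Cont] to [Poly] and sends a bundle to the sum of the corepresentables
     of its fibers. *)
  apply/equivalent_sym/weak_equiv_equivalent.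
  exact: weak_equiv_comp fam_poly_weak_equiv cont_fibers_weak_equiv.
apply/equivalent_sym/weak_equiv_equivalent.
exact: weak_equiv_comp fam_dir_weak_equiv bun_fibers_weak_equiv.
Qed.
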